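(* Let $\boldsymbol\alpha=(\frac\pi2,\frac\pi2,\alpha_z)$ with $\alpha_z\in[0,\frac\pi2]$ (the edge of two-qubit unitaries joining DCNOT to SWAP). Let $F_{\boldsymbol\phi}\in[0,\infty]$ be the average trace of the quantum Fisher information matrix of the output state $\mathcal N_{\boldsymbol\theta}(\boldsymbol\phi)=\mathrm{Tr}_F\big(U_{\boldsymbol\alpha}(|\boldsymbol\phi\rangle\langle\boldsymbol\phi|\otimes\boldsymbol\theta)U_{\boldsymbol\alpha}^\dagger\big)$ with respect to the environment parameters $(r,\theta_1,\theta_2)$, and let $\overline F$ be its maximum over pure probe states $|\boldsymbol\phi\rangle=\cos\frac{\phi_1}{2}|0\rangle+e^{i\phi_2}\sin\frac{\phi_1}{2}|1\rangle$, $\phi_1\in[0,\pi]$, $\phi_2\in[0,2\pi]$ (see context). Then $\overline F=+\infty$ for every $\alpha_z\in[0,\frac\pi2]$.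
   Context: All systems $A,B,E,F$ are qubits. In the basis $\{|0\rangle_A|0\rangle_E,|0\rangle_A|1\rangle_E,|1\rangle_A|0\rangle_E,|1\rangle_A|1\rangle_E\}$ (output factors $B$ first, $F$ second), $$U_{\boldsymbol\alpha}=\begin{pmatrix}\cos\frac{\alpha_x-\alpha_y}{2}&0&0&-i\sin\frac{\alpha_x-\alpha_y}{2}\\0&e^{i\alpha_z}\cos\frac{\alpha_x+\alpha_y}{2}&-ie^{i\alpha_z}\sin\frac{\alpha_x+\alpha_y}{2}&0\\0&-ie^{i\alpha_z}\sin\frac{\alpha_x+\alpha_y}{2}&e^{i\alpha_z}\cos\frac{\alpha_x+\alpha_y}{2}&0\\-i\sin\frac{\alpha_x-\alpha_y}{2}&0&0&\cos\frac{\alpha_x-\alpha_y}{2}\end{pmatrix}.$$ The environment ($E$) state with parameters $(r,\theta_1,\theta_2)\in\Theta=[0,\frac12]\times[0,\pi]\times[0,2\pi]$ is $\boldsymbol\theta=\frac12 I+r\sin\theta_1\cos\theta_2\,\sigma_x+r\sin\theta_1\sin\theta_2\,\sigma_y+r\cos\theta_1\,\sigma_z$, with $\sigma_x,\sigma_y,\sigma_z$ the Pauli matrices. The prior measure is $\pi(\boldsymbol\theta)\,d\boldsymbol\theta=\frac{1}{2\pi}\sin\frac{\theta_1}{2}\,dr\,d\theta_1\,d\theta_2$. For a family $\rho=\rho(r,\theta_1,\theta_2)$ of qubit states, the quantum Fisher information matrix $\mathcal F$ has entries $\mathcal F_{ab}=\mathrm{tr}[(\partial_a\rho)(\partial_b\rho)]+\frac{\mathrm{tr}[\rho(\partial_a\rho)\rho(\partial_b\rho)]}{\det\rho}$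 when $\det\rho\neq0$, and $\mathcal F_{ab}=2\,\mathrm{tr}[(\partial_a\rho)(\partial_b\rho)]$ when $\rho$ is a family of pure states, where $a,b\in\{r,\theta_1,\theta_2\}$. For the output family $\rho=\mathcal N_{\boldsymbol\theta}(\boldsymbol\phi)$, $F_{\boldsymbol\phi}:=\int_\Theta\mathrm{tr}\{\mathcal F(\boldsymbol\theta)\}\,\pi(\boldsymbol\theta)\,d\boldsymbol\theta$ (possibly $+\infty$), and $\overline F:=\max_{\boldsymbol\phi}F_{\boldsymbol\phi}$. *)

(* Defs.v *)
(* MathComp-Analysis over an arbitrary [R : realType]; the complex numbers are
   [R[i]] from mathcomp-real-closed. *)
From mathcomp Require Export all_boot all_order all_algebra.
From mathcomp Require Export all_classical all_reals all_analysis.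
From mathcomp Require Export measurable_realfun.
From mathcomp.real_closed Require Export complex mxtens.

Set Implicit Arguments.
Unset Strict Implicit.
Unset Printing Implicit Defensive.

Export Order.TTheory GRing.Theory Num.Theory.
Export numFieldNormedType.Exports.
Global Open Scope classical_set_scope.
Global Open Scope ring_scope.
Global Open Scope complex_scope.

Section QFI.
Variable R : realType.
Local Notation C := R[i].

Definition mx_of_rows (m n : nat) (rows : seq (seq C)) : 'M[C]_(m, n) :=
  \matrix_(i, j) nth 0 (nth [::] rows i) j.

(* exp(i x) *)
Definition cexpi (x : R) : C := cos x +i* sin x.

Definition adjmx (m n : nat) (A : 'M[C]_(m, n)) : 'M[C]_(n, m) :=
  (map_mx (@conjc R) A)^T.

Definition sigma_x : 'M[C]_2 := mx_of_rows 2 2 [:: [:: 0; 1]; [:: 1; 0]].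
Definition sigma_y : 'M[C]_2 := mx_of_rows 2 2 [:: [:: 0; - 'i]; [:: 'i; 0]].
Definition sigma_z : 'M[C]_2 := mx_of_rows 2 2 [:: [:: 1; 0]; [:: 0; -1]].

(* Rows and columns of ['M_(2 * 2)] are numbered as in [tensmx]: the index of
   |i>|j> is [mxtens_index (i, j)], whose value is [i * 2 + j].  The columns
   refer to the input A (x) E and the rows to the output B (x) F. *)
Definition Ualpha (ax ay az : R) : 'M[C]_(2 * 2) :=
  let cm := (cos ((ax - ay) / 2))%:C in
  let sm := (sin ((ax - ay) / 2))%:C in
  let cp := (cos ((ax + ay) / 2))%:C in
  let sp := (sin ((ax + ay) / 2))%:C in
  let ez := cexpi az in
  mx_of_rows (2 * 2) (2 * 2)
    [:: [:: cm;          0;                0;                - 'i * sm ];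
        [:: 0;           ez * cp;          - 'i * ez * sp;   0         ];
        [:: 0;           - 'i * ez * sp;   ez * cp;          0         ];
        [:: - 'i * sm;   0;                0;                cm        ]].

(* Trace over the second tensor factor. *)
Definition ptrace2 (X : 'M[C]_(2 * 2)) : 'M[C]_2 :=
  \matrix_(i, j) \sum_(k < 2) X (mxtens_index (i, k)) (mxtens_index (j, k)).

(* A parameter point is ((r, theta_1), theta_2).  The families of states below
   are defined by their formulas on the whole of R^3, so that two-sided partial
   derivatives also make sense at the boundary of [Theta]. *)
Definition param : Type := (R * R * R)%type.

Definition env_state (t : param) : 'M[C]_2 :=
  let: (r, t1, t2) := t in
  (2^-1 : C) *: 1%:M
  + (r * sin t1 * cos t2)%:C *: sigma_x
  + (r * sin t1 * sin t2)%:C *: sigma_y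
  + (r * cos t1)%:C *: sigma_z.

Definition Theta : set param :=
  (`[0, 2^-1] `*` `[0, pi]) `*` `[0, 2 * pi].

(* Density of the prior with respect to Lebesgue measure dr dtheta_1 dtheta_2. *)
Definition prior (t : param) : R :=
  let: (r, t1, t2) := t in (2 * pi)^-1 * sin (t1 / 2).

(* No type is given here: an annotation [set param -> \bar R] would select
   another, only convertible, measurable structure on R, and the measure
   structures of [lebesgue_measure] would no longer be inferred. *)
Definition lebesgue3 :=
  (@lebesgue_measure R \x @lebesgue_measure R \x @lebesgue_measure R)%E.

(* The pure probe state |phi>, and the admissible values of (phi_1, phi_2). *)
Definition probe (phi : R * R) : 'cV[C]_2 :=
  mx_of_rows 2 1 [:: [:: (cos (phi.1 / 2))%:C];
                     [:: cexpi phi.2 * (sin (phi.1 / 2))%:C]].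

Definition Phi : set (R * R) := `[0, pi] `*` `[0, 2 * pi].

Definition output (ax ay az : R) (phi : R * R) (t : param) : 'M[C]_2 :=
  let U := Ualpha ax ay az in
  ptrace2 (U *m ((probe phi *m adjmx (probe phi)) *t env_state t) *m adjmx U).

Definition unit_vec (a : 'I_3) : param :=
  ((a == 0 :> nat)%:R, (a == 1 :> nat)%:R, (a == 2 :> nat)%:R).

(* Entrywise partial derivative; the derivative of a complex-valued function of
   real variables is taken on the real and imaginary parts. *)
Definition dpart (rho : param -> 'M[C]_2) (a : 'I_3) (t : param) : 'M[C]_2 :=
  \matrix_(i, j)
    ('D_(unit_vec a) (fun s : param => complex.Re (rho s i j)) t
     +i* 'D_(unit_vec a) (fun s : param => complex.Im (rho s i j)) t).

(* The case distinction is made at each parameter point: a qubit state is pure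
   exactly when its determinant vanishes.  The entries of an output family are
   analytic in the parameters, so its determinant vanishes either identically
   (a family of pure states) or only on a null set of [Theta]. *)
Definition QFI (rho : param -> 'M[C]_2) (t : param) : 'M[C]_3 :=
  \matrix_(a, b)
    let da := dpart rho a t in
    let db := dpart rho b t in
    if \det (rho t) != 0
    then \tr (da *m db) + \tr (rho t *m da *m rho t *m db) / \det (rho t)
    else 2 * \tr (da *m db).

(* The trace of the QFI matrix of a family of Hermitian matrices is real, so
   [Re] only changes its type. *)
Definition avg_QFI (rho : param -> 'M[C]_2) : \bar R :=
  (\int[lebesgue3]_(t in Theta)
     (complex.Re (\tr (QFI rho t)) * prior t)%:E)%E.

Definition Fphi (ax ay az : R) (phi : R * R) : \bar R :=
  avg_QFI (output ax ay az phi).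

Definition is_max_of (A : set (\bar R)) (m : \bar R) : Prop :=
  A m /\ ubound A m.

End QFI.

(* Main.v *)
Require Import Defs.
From mathcomp Require Import ring lra.

(* At the edge (pi/2, pi/2, az) the unitary is a swap times the phase
   - i e^(i az) on the odd-parity basis vectors.  For the probe |0> the output
   is therefore the environment state with its Bloch vector rotated about the
   z-axis.  A diagonal entry of the Fisher matrix of a qubit with Bloch vector
   2v is 4 |v'|^2 + 4 (v.v')^2 / det rho, where v' is the partial derivative of
   v.  All of these are nonnegative, and F_rr = 1 / (1/4 - r^2) has a
   non-integrable singularity at r = 1/2: on the box
   1/2 - 2^-(n+1) <= r < 1/2 - 2^-(n+2), pi/2 <= theta_1 <= pi, the integrand
   is at least c 2^(n+1), so that each of these disjoint boxes contributes at
   least the same positive amount to the integral. *)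

(** * Divergence of an integral from disjoint pieces *)

Import HBNNSimple.

(** The integral of a nonnegative function is a supremum over the simple functions below it, and a
    simple function below [f] is also below [g]. *)
Lemma ge0_le_integral_nonmeasurable (R : realType) (d : measure_display)
    (T : measurableType d) (mu : {measure set T -> \bar R}) (f g : T -> \bar R) :
  (forall x, 0 <= f x)%E -> (forall x, f x <= g x)%E ->
  (\int[mu]_x f x <= \int[mu]_x g x)%E.
Proof.
move=> f0 fg; have g0 x : (0 <= g x)%E by exact: le_trans (f0 x) (fg x).
rewrite !ge0_integralTE//; apply: le_ereal_sup => _ [h hf <-].
by exists h => // x; exact: le_trans (hf x) (fg x).
Qed.

(** Each piece contributes at least [c]. Countable additivity is applied to the measurable minorant
    [g], and [f] enters only through monotonicity, so measurability of the Fisher information never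
    has to be proved. *)
Lemma integral_pinfty_pieces (R : realType) (d : measure_display)
    (T : measurableType d) (mu : {measure set T -> \bar R}) (A : (set T)^nat) (D : set T)
    (f g : T -> R) (c : R) :
  (forall n, measurable (A n)) -> trivIset setT A ->
  measurable_fun setT g -> measurable D -> 0 < c ->
  (forall t, D t -> 0 <= f t) ->
  (forall n, A n `<=` D) ->
  (forall n t, A n t -> 0 <= g t <= f t) ->
  (forall n, exists2 m : R, (forall t, A n t -> m <= g t) &
     (0 <= m) && (c%:E <= m%:E * mu (A n))%E) ->
  (\int[mu]_(t in D) (f t)%:E = +oo)%E.
Proof.
move=> mA tA mg mD c0 f0 AD gf gm.
pose U := \bigcup_n A n.
have mgU E : measurable E -> measurable_fun E (EFin \o g).
  by move=> mE; apply/measurable_EFinP; exact: measurable_funS mg.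
have g0 t : U t -> 0 <= g t by case=> n _ /gf /andP[].
(* Both integrands are extended by zero to the whole space and compared pointwise there. *)
have le1 : (\int[mu]_(t in U) (g t)%:E <= \int[mu]_(t in D) (f t)%:E)%E.
  rewrite integral_mkcond [leRHS]integral_mkcond.
  apply: ge0_le_integral_nonmeasurable => t; rewrite /patch.
    by case: ifPn => // /set_mem /g0; rewrite lee_fin.
  case: ifPn => [/set_mem [n _ Ant]|_].
    by rewrite mem_set ?lee_fin; [case/andP: (gf n t Ant)|exact: AD Ant].
  by case: ifPn => // /set_mem /f0; rewrite lee_fin.
suff SU : (\int[mu]_(t in U) (g t)%:E = +oo)%E.
  by apply/eqP; rewrite -leye_eq -SU.
rewrite (ge0_integral_bigcup _ mA)//; last first.
  exact/mgU/bigcup_measurable.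
have cle n : (c%:E <= \int[mu]_(t in A n) (g t)%:E)%E.
  have [m mg' /andP[m0 cm]] := gm n; apply: le_trans cm _.
  rewrite -(integral_cst _ (mA n)).
  apply: ge0_le_integral => //; first exact: mgU.
apply: eq_infty => r.
(* By the Archimedean property, finitely many terms of size [c] already reach [r]. *)
have [N rN] : exists N : nat, r <= N%:R * c.
  exists (Num.bound `|r / c|).
  rewrite -ler_pdivrMr//; apply: le_trans (ler_norm _) _.
  exact/ltW/archi_boundP/normr_ge0.
apply: le_trans (nneseries_lim_ge N _); last first.
  by move=> n _ _; apply: le_trans (cle n); rewrite lee_fin ltW.
apply: (@le_trans _ _ (\sum_(0 <= i < N) c%:E)%E); last exact: lee_sum.
by rewrite sumEFin lee_fin sumr_const_nat subn0 -mulr_natl.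
Qed.

Section QFI_divergence.
Variable R : realType.
Local Notation C := R[i].
Implicit Types w x y z a b c : R.

(** * Fisher information of matrices [w I + x sigma_x + y sigma_y + z sigma_z] *)

Definition bloch w x y z : 'M[C]_2 :=
  mx_of_rows 2 2 [:: [:: (w + z)%:C; x -i* y]; [:: x +i* y; (w - z)%:C]].

Lemma mxtrace_bloch_sqr a b c :
  \tr (bloch 0 a b c *m bloch 0 a b c) = (2 * (a ^+ 2 + b ^+ 2 + c ^+ 2))%:C.
Proof.
rewrite /mxtrace !big_ord_recl !big_ord0 !mxE !big_ord_recl !big_ord0 !mxE /=.
by simpc; congr (_ +i* _); ring.
Qed.

Lemma det_bloch w x y z :
  \det (bloch w x y z) = (w ^+ 2 - x ^+ 2 - y ^+ 2 - z ^+ 2)%:C.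
Proof.
rewrite (expand_det_row _ ord0) !big_ord_recl big_ord0 /cofactor !det_mx11.
rewrite !mxE /=.
by simpc; congr (_ +i* _); ring.
Qed.

(** The first summand carries the determinant as a factor, so after division by it only the squared
    inner product stays singular. *)
Lemma mxtrace_bloch_mul4 w x y z a b c :
  \tr (bloch w x y z *m bloch 0 a b c *m bloch w x y z *m bloch 0 a b c) =
  (2 * ((w ^+ 2 - x ^+ 2 - y ^+ 2 - z ^+ 2) * (a ^+ 2 + b ^+ 2 + c ^+ 2)
        + 2 * (x * a + y * b + z * c) ^+ 2))%:C.
Proof.
rewrite -!mulmxA mulmxA /mxtrace.
rewrite !big_ord_recl !big_ord0 !mxE !big_ord_recl !big_ord0.
rewrite ![(bloch w x y z *m bloch 0 a b c) _ _]mxE.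
rewrite !big_ord_recl !big_ord0 !mxE /=.
by simpc; congr (_ +i* _); ring.
Qed.

(* For a pure state the QFI has no determinant term; with [0^-1 = 0] the same
   closed formula covers both cases. *)
Lemma QFI_bloch (rho : param R -> 'M[C]_2) t (k : 'I_3) w x y z a b c :
  rho t = bloch w x y z -> dpart rho k t = bloch 0 a b c ->
  QFI rho t k k =
  (4 * (a ^+ 2 + b ^+ 2 + c ^+ 2)
   + 4 * (x * a + y * b + z * c) ^+ 2
     * (w ^+ 2 - x ^+ 2 - y ^+ 2 - z ^+ 2)^-1)%:C.
Proof.
move=> rhot drhot; rewrite mxE /= rhot drhot mxtrace_bloch_sqr det_bloch.
rewrite mxtrace_bloch_mul4; set D := (w ^+ 2 - _ - _ - _).
have [->|D0] := eqVneq D 0.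
  rewrite eqxx /= invr0 mulr0 addr0.
  rewrite -[2]/(2%:R) -(rmorph_nat (real_complex R)) -rmorphM /=.
  by congr (_%:C); ring.
rewrite -(rmorph0 (real_complex R)) (inj_eq (@complexI R)) D0 /=.
by rewrite -fmorphV -rmorphM -rmorphD /=; congr (_%:C); field.
Qed.

(** * Directional derivatives by one-variable calculus *)

(** The difference quotients of [f] at [t] along [v] are those at [0] of its restriction to the
    line, so the one-variable rules become available. *)
Lemma is_derive_line (V : normedModType R) (f : V -> R) (t v : V) (df : R) :
  is_derive (0 : R) 1 (fun h : R => f (h *: v + t)) df -> is_derive t v f df.
Proof.
have E : (fun h : R => h^-1 *: ((f \o shift t) (h *: v) - f t)) =
    (fun h : R => h^-1 *: (((fun h : R => f (h *: v + t)) \o shift 0)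
       (h *: (1 : R)) - f ((0 : R) *: v + t))).
  by apply/funext => h /=; rewrite addr0 scale0r add0r [h *: 1]mulr1.
by move=> [h1 h2]; split; [rewrite /derivable E | rewrite /derive E].
Qed.

Lemma is_derive_affine (v c x : R) : is_derive x 1 (fun h : R => h * v + c) v.
Proof.
have -> : (fun h : R => h * v + c) = (v *: id + cst c :> (R -> R)).
  by apply/funext => h; rewrite /= mulrC.
by apply: is_derive_eq; rewrite addr0 [LHS]mulr1.
Qed.

Lemma is_derive1_mulM (f g k : R -> R) (x df dg dk : R) :
  is_derive x 1 f df -> is_derive x 1 g dg -> is_derive x 1 k dk ->
  is_derive x 1 (fun h => f h * g h * k h)
    (df * g x * k x + f x * dg * k x + f x * g x * dk).
Proof.
move=> hf hg hk.
have -> : (fun h => f h * g h * k h) = (f * g) * k by [].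
apply: is_derive_eq; rewrite /GRing.scale /=.
by rewrite -[(f * g) x]/(f x * g x); ring.
Qed.

Lemma is_derive_sin_affine (v c x : R) :
  is_derive x 1 (fun h : R => sin (h * v + c)) (cos (x * v + c) * v).
Proof.
have h := is_derive_affine v c x.
exact: (@is_derive1_comp _ sin _ x _ _ _ h).
Qed.

Lemma is_derive_cos_affine (v c x : R) :
  is_derive x 1 (fun h : R => cos (h * v + c)) (- sin (x * v + c) * v).
Proof.
have h := is_derive_affine v c x.
exact: (@is_derive1_comp _ cos _ x _ _ _ h).
Qed.

(** * The unitary at the edge and its output states *)

Definition swap_phase (az : R) (a e : 'I_2) : C :=
  if a == e then 1 else - 'i * cexpi az.

(** The half-difference of the angles is [0] and the half-sum is [pi / 2]: the even-parity block
    becomes the identity, the odd-parity block purely off-diagonal. *)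
Lemma Ualpha_pihalf (az : R) (b f a e : 'I_2) :
  Ualpha (pi / 2) (pi / 2) az (mxtens_index (b, f)) (mxtens_index (a, e)) =
  if (f == a) && (b == e) then swap_phase az a e else 0.
Proof.
have E0 : (pi / 2 - pi / 2) / 2 = 0 :> R by rewrite subrr mul0r.
have E1 : (pi / 2 + pi / 2) / 2 = pi / 2 :> R by field.
rewrite mxE E0 E1 cos0 sin0 cos_pihalf sin_pihalf /swap_phase.
case: b => [] [|[|//]] ?; case: f => [] [|[|//]] ?;
case: a => [] [|[|//]] ?; case: e => [] [|[|//]] ? /=;
by rewrite ?mulr0 ?mulr1.
Qed.

Lemma sum_mxtens (V : nmodType) (m n : nat) (F : 'I_(m * n) -> V) :
  \sum_k F k = \sum_i \sum_j F (mxtens_index (i, j)).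
Proof.
rewrite pair_big; apply: reindex => /=.
exists (@mxtens_unindex m n) => i; first by rewrite mxtens_indexK; case: i.
by rewrite -[RHS]mxtens_unindexK; case: (mxtens_unindex i).
Qed.

Lemma adjmxE (m n : nat) (A : 'M[C]_(m, n)) i j :
  adjmx A i j = conjc (A j i).
Proof. by rewrite !mxE. Qed.

(** The swap moves the environment to [B] and the probe to [F], so the partial trace keeps only
    diagonal entries of the probe, up to the phases. *)
Lemma output_pihalfE (az : R) (phi : R * R) (t : param R) (i j : 'I_2) :
  output (pi / 2) (pi / 2) az phi t i j =
  \sum_k swap_phase az k i * ((probe phi *m adjmx (probe phi)) k k
    * env_state t i j) * conjc (swap_phase az k j).
Proof.
rewrite mxE; set P := probe phi *m _; apply: eq_bigr => k _.
rewrite mxE sum_mxtens.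
(* In the adjoint factor, the row [(j, k)] of the unitary is nonzero only at column [(k, j)]. *)
rewrite (bigD1 k) //= [X in _ + X]big1 ?addr0; last first.
  move=> a ak; apply: big1 => e _.
  by rewrite adjmxE Ualpha_pihalf (eq_sym k) (negbTE ak) [conjc _]conjc0 mulr0.
rewrite (bigD1 j) //= [X in _ + X]big1 ?addr0; last first.
  move=> e ej.
  rewrite adjmxE Ualpha_pihalf (eq_sym j) (negbTE ej) andbF.
  by rewrite [conjc _]conjc0 mulr0.
rewrite mxE sum_mxtens.
(* In the left factor, the row [(i, k)] is nonzero only at column [(k, i)]. *)
rewrite (bigD1 k) //= [X in _ + X]big1 ?addr0; last first.
  move=> a ak; apply: big1 => e _.
  by rewrite Ualpha_pihalf eq_sym (negbTE ak) /= mul0r.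
rewrite (bigD1 i) //= [X in _ + X]big1 ?addr0; last first.
  by move=> e ei; rewrite Ualpha_pihalf (eq_sym i) (negbTE ei) andbF /= mul0r.
by rewrite Ualpha_pihalf tensmxE adjmxE Ualpha_pihalf !eqxx.
Qed.

(* The factor [* 1] gives the three coordinates the shape that
   [is_derive1_mulM] differentiates. *)
Lemma output_pihalf_ket0 (az : R) (t : param R) :
  output (pi / 2) (pi / 2) az (0, 0) t =
  bloch 2^-1 (t.1.1 * sin t.1.2 * sin (t.2 + az))
    (t.1.1 * sin t.1.2 * - cos (t.2 + az)) (t.1.1 * cos t.1.2 * 1).
Proof.
case: t => [[r t1] t2] /=; apply/matrixP => i j.
(* Only [k = 0] contributes; the phase [- i e^(i az)] shifts the azimuth [t.2] by [az - pi / 2],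
   hence the sine and the negated cosine. *)
rewrite output_pihalfE !big_ord_recl big_ord0.
rewrite !mxE !big_ord_recl !big_ord0 !mxE /=.
rewrite mul0r cos0 sin0 /swap_phase sinD cosD.
have V2 : (2^-1 : C) = (2^-1)%:C by rewrite fmorphV rmorph_nat.
rewrite V2 /cexpi.
have S := sin2cos2 az.
by case: i => [] [|[|//]] ?; case: j => [] [|[|//]] ? /=;
  rewrite ?mulr1n ?mulr0n; simpc; congr (_ +i* _); ring: S.
Qed.

(** * Partial derivatives of the output family *)

Lemma Re_bloch w x y z (i j : 'I_2) : complex.Re (bloch w x y z i j) =
  if i == j then (if i == ord0 then w + z else w - z) else x.
Proof.
by rewrite mxE; case: i => [] [|[|//]] ?; case: j => [] [|[|//]] ?.
Qed.

Lemma Im_bloch w x y z (i j : 'I_2) : complex.Im (bloch w x y z i j) =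
  if i == j then 0 else if i == ord0 then - y else y.
Proof.
by rewrite mxE; case: i => [] [|[|//]] ?; case: j => [] [|[|//]] ?.
Qed.

Lemma dpart_bloch (rho : param R -> 'M[C]_2) w (X Y Z : param R -> R)
    (k : 'I_3) t a b c :
  rho = (fun s => bloch w (X s) (Y s) (Z s)) ->
  is_derive t (unit_vec R k) X a -> is_derive t (unit_vec R k) Y b ->
  is_derive t (unit_vec R k) Z c ->
  dpart rho k t = bloch 0 a b c.
Proof.
move=> -> hX hY hZ.
have h0 : is_derive t (unit_vec R k) (fun=> 0 : R) 0 by exact: is_derive_cst.
have hNY : is_derive t (unit_vec R k) (fun s => - Y s) (- b) := is_deriveN hY.
(* The forms [0 + c] and [0 - c] match the diagonal of [bloch 0 a b c]. *)
have hwZ : is_derive t (unit_vec R k) (fun s => w + Z s) (0 + c).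
  exact: (is_deriveD (is_derive_cst w _ _) hZ).
have hwNZ : is_derive t (unit_vec R k) (fun s => w - Z s) (0 - c).
  exact: (is_deriveB (is_derive_cst w _ _) hZ).
apply/matrixP => i j; rewrite !mxE.
under eq_fun do rewrite Re_bloch.
under [in X in _ +i* X]eq_fun do rewrite Im_bloch.
by case: i => [] [|[|//]] ?; case: j => [] [|[|//]] ? /=; rewrite !derive_val.
Qed.

Lemma is_derive_Ncos_affine (v c x : R) :
  is_derive x 1 (fun h : R => - cos (h * v + c)) (sin (x * v + c) * v).
Proof.
by rewrite -[_ * v]opprK -mulNr; exact: is_deriveN (is_derive_cos_affine v c x).
Qed.

Lemma is_derive_spherical_x (phase : R) (t v : param R) :
  is_derive t v (fun s : param R => s.1.1 * sin s.1.2 * sin (s.2 + phase))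
    (v.1.1 * sin t.1.2 * sin (t.2 + phase)
     + t.1.1 * (cos t.1.2 * v.1.2) * sin (t.2 + phase)
     + t.1.1 * sin t.1.2 * (cos (t.2 + phase) * v.2)).
Proof.
apply: is_derive_line.
have := is_derive1_mulM _ _ _ _ _ _ _ (is_derive_affine v.1.1 t.1.1 0)
  (is_derive_sin_affine v.1.2 t.1.2 0)
  (is_derive_sin_affine v.2 (t.2 + phase) 0).
rewrite !mul0r !add0r.
(* The phase was put into the base point of the affine argument; reassociating restores
   [s.2 + phase] on the line. *)
by under eq_fun do rewrite (addrA _ t.2).
Qed.

Lemma is_derive_spherical_y (phase : R) (t v : param R) :
  is_derive t v (fun s : param R => s.1.1 * sin s.1.2 * - cos (s.2 + phase))
    (v.1.1 * sin t.1.2 * - cos (t.2 + phase)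
     + t.1.1 * (cos t.1.2 * v.1.2) * - cos (t.2 + phase)
     + t.1.1 * sin t.1.2 * (sin (t.2 + phase) * v.2)).
Proof.
apply: is_derive_line.
have := is_derive1_mulM _ _ _ _ _ _ _ (is_derive_affine v.1.1 t.1.1 0)
  (is_derive_sin_affine v.1.2 t.1.2 0)
  (is_derive_Ncos_affine v.2 (t.2 + phase) 0).
rewrite !mul0r !add0r.
by under eq_fun do rewrite (addrA _ t.2).
Qed.

Lemma is_derive_spherical_z (t v : param R) :
  is_derive t v (fun s : param R => s.1.1 * cos s.1.2 * 1)
    (v.1.1 * cos t.1.2 + t.1.1 * (- sin t.1.2 * v.1.2)).
Proof.
apply: is_derive_line.
have := is_derive1_mulM _ _ _ _ _ _ _ (is_derive_affine v.1.1 t.1.1 0)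
  (is_derive_cos_affine v.1.2 t.1.2 0) (is_derive_cst (1 : R) (0 : R) 1).
by rewrite !mul0r !add0r !mulr1 mulr0 addr0.
Qed.

Lemma dpart_output_pihalf_ket0 (az : R) (k : 'I_3) (t : param R) :
  let v := unit_vec R k in
  dpart (output (pi / 2) (pi / 2) az (0, 0)) k t =
  bloch 0
    (v.1.1 * sin t.1.2 * sin (t.2 + az)
     + t.1.1 * (cos t.1.2 * v.1.2) * sin (t.2 + az)
     + t.1.1 * sin t.1.2 * (cos (t.2 + az) * v.2))
    (v.1.1 * sin t.1.2 * - cos (t.2 + az)
     + t.1.1 * (cos t.1.2 * v.1.2) * - cos (t.2 + az)
     + t.1.1 * sin t.1.2 * (sin (t.2 + az) * v.2))
    (v.1.1 * cos t.1.2 + t.1.1 * (- sin t.1.2 * v.1.2)).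
Proof.
move=> v; apply: dpart_bloch (is_derive_spherical_x az t v)
  (is_derive_spherical_y az t v) (is_derive_spherical_z t v).
by apply/funext => s; exact: output_pihalf_ket0.
Qed.

(** * Fisher information of the output for the probe |0> *)

(** In spherical coordinates the vector has squared norm [r ^+ 2], and its inner product with its
    derivative is [r] times the derivative of [r]. Hence only the radial direction sees the
    determinant. *)
Lemma QFI_output_diag (az : R) (k : 'I_3) (t : param R) :
  let v := unit_vec R k in
  let dx := v.1.1 * sin t.1.2 * sin (t.2 + az)
     + t.1.1 * (cos t.1.2 * v.1.2) * sin (t.2 + az)
     + t.1.1 * sin t.1.2 * (cos (t.2 + az) * v.2) in
  let dy := v.1.1 * sin t.1.2 * - cos (t.2 + az)
     + t.1.1 * (cos t.1.2 * v.1.2) * - cos (t.2 + az)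
     + t.1.1 * sin t.1.2 * (sin (t.2 + az) * v.2) in
  let dz := v.1.1 * cos t.1.2 + t.1.1 * (- sin t.1.2 * v.1.2) in
  QFI (output (pi / 2) (pi / 2) az (0, 0)) t k k =
  (4 * (dx ^+ 2 + dy ^+ 2 + dz ^+ 2)
   + 4 * (t.1.1 * v.1.1) ^+ 2 * (2^-1 ^+ 2 - t.1.1 ^+ 2)^-1)%:C.
Proof.
move=> v dx dy dz.
rewrite (QFI_bloch _ _ _ _ _ _ _ _ _ _ (output_pihalf_ket0 az t)
  (dpart_output_pihalf_ket0 az k t)) -/v -/dx -/dy -/dz.
have [S1 S2] := (sin2cos2 t.1.2, sin2cos2 (t.2 + az)).
congr (_ + 4 * _ ^+ 2 * _^-1)%:C; last by ring: S1 S2.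
by rewrite /dx /dy /dz; ring: S1 S2.
Qed.

(** The range includes [r = 1/2], where the determinant vanishes and [0^-1 = 0] removes the singular
    term. *)
Lemma QFI_output_diag_ge0 (az : R) (k : 'I_3) (t : param R) :
  0 <= t.1.1 <= 2^-1 ->
  exists2 q, 0 <= q & QFI (output (pi / 2) (pi / 2) az (0, 0)) t k k = q%:C.
Proof.
move=> /andP[r0 r2]; rewrite QFI_output_diag; eexists; last by reflexivity.
have D0 : 0 <= 2^-1 ^+ 2 - t.1.1 ^+ 2 by nra.
apply: addr_ge0; first by rewrite mulr_ge0 ?addr_ge0 ?sqr_ge0.
by rewrite mulr_ge0 ?invr_ge0// mulr_ge0 ?sqr_ge0.
Qed.

Lemma trace_QFI_output_ge0 (az : R) (t : param R) :
  0 <= t.1.1 <= 2^-1 ->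
  0 <= complex.Re (\tr (QFI (output (pi / 2) (pi / 2) az (0, 0)) t)).
Proof.
move=> rt; rewrite /mxtrace (big_morph _ (raddfD (@complex.Re R)) (erefl _)).
apply: sumr_ge0 => k _.
by have [q q0 ->] := QFI_output_diag_ge0 az k t rt.
Qed.

(** The radial entry is [1 / ((1/2 - r) (1/2 + r))] with [1/2 + r <= 1], and the two angular entries
    are nonnegative. *)
Lemma trace_QFI_output_ge (az : R) (t : param R) :
  0 <= t.1.1 < 2^-1 ->
  (2^-1 - t.1.1)^-1 <=
  complex.Re (\tr (QFI (output (pi / 2) (pi / 2) az (0, 0)) t)).
Proof.
move=> /andP[r0 r2].
have rt : 0 <= t.1.1 <= 2^-1 by rewrite r0 ltW.
pose D := (2^-1) ^+ 2 - t.1.1 ^+ 2.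
have D0 : 0 < D by rewrite /D; nra.
have [S1 S2] := (sin2cos2 t.1.2, sin2cos2 (t.2 + az)).
have rr : QFI (output (pi / 2) (pi / 2) az (0, 0)) t ord0 ord0 = D^-1%:C.
  rewrite QFI_output_diag (_ : unit_vec R ord0 = (1, 0, 0)) //= -/D.
  rewrite !mulr0 !mul1r !mul0r !addr0 mulr1; congr (_%:C).
  have -> : (sin t.1.2 * sin (t.2 + az)) ^+ 2
    + (sin t.1.2 * - cos (t.2 + az)) ^+ 2 + cos t.1.2 ^+ 2 = 1.
    by ring: S1 S2.
  (* Since [4 D + 4 r^2 = 1], the entry [4 + 4 r^2 / D] equals [1 / D]. *)
  apply: (mulIf (lt0r_neq0 D0)).
  by rewrite mulrDl divfK ?mulVf ?lt0r_neq0// /D; field.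
rewrite /mxtrace !big_ord_recl big_ord0 addr0 rr.
have [q1 q10 ->] := QFI_output_diag_ge0 az (lift ord0 ord0) t rt.
have [q2 q20 ->] := QFI_output_diag_ge0 az (lift ord0 (lift ord0 ord0)) t rt.
rewrite /=.
apply: (@le_trans _ _ D^-1); last by rewrite lerDl addr_ge0.
by rewrite lef_pV2 ?posrE ?subr_gt0// /D; nra.
Qed.

(** * Dyadic boxes approaching the pure states *)

(** Half-open in [r], so that consecutive boxes are disjoint; box [0] starts at [r = 0]. *)
Definition dyadic_box (n : nat) : set (param R) :=
  (`[2^-1 - 2^-1 ^+ n.+1, 2^-1 - 2^-1 ^+ n.+2[ `*` `[pi / 2, pi])
  `*` `[0, 2 * pi].

Lemma measurable_dyadic_box n : measurable (dyadic_box n).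
Proof.
by apply: measurableX; [apply: measurableX|]; exact: measurable_itv.
Qed.

Lemma lebesgue3_dyadic_box n :
  lebesgue3 (dyadic_box n) = (2^-1 ^+ n.+2 * (pi / 2) * (2 * pi))%:E.
Proof.
rewrite /lebesgue3 product_measure1E //=; last exact: measurableX.
rewrite product_measure1E //= !lebesgue_measure_itv /= !lte_fin.
have pi0 := pi_gt0 R.
have e0 : (0 : R) < 2^-1 ^+ n.+2 by rewrite exprn_gt0.
have e1 : (2^-1 : R) ^+ n.+1 = 2 * 2^-1 ^+ n.+2.
  by rewrite (exprS _ n.+1); field.
have l1 : (2^-1 : R) - 2^-1 ^+ n.+1 < 2^-1 - 2^-1 ^+ n.+2 by lra.
have l2 : (pi : R) / 2 < pi by lra.
have l3 : 0 < 2 * pi :> R by lra.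
rewrite l1 l2 l3.
by rewrite -!EFinB -!EFinM; congr EFin; rewrite e1; field.
Qed.

Lemma trivIset_dyadic_box : trivIset setT dyadic_box.
Proof.
have key n m t : dyadic_box n t -> dyadic_box m t -> (m <= n)%N.
  move=> [[]] /=; rewrite in_itv /= => /andP[h1 h2] _ _.
  move=> [[]] /=; rewrite in_itv /= => /andP[h3 h4] _ _.
  rewrite leqNgt; apply/negP => nm.
  (* For [n < m], box [m] starts no earlier in [r] than box [n] ends. *)
  have : (2^-1 : R) ^+ m.+1 <= 2^-1 ^+ n.+2.
    by rewrite ler_wiXn2l// ?invr_ge0// invf_le1// ler1n.
  by move: (le_lt_trans h3 h2); lra.
move=> n m _ _ [t [tn tm]].
by apply/eqP; rewrite eqn_leq (key _ _ _ tn tm) (key _ _ _ tm tn).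
Qed.

(** The prior at [theta_1 = pi / 2], its minimum on the boxes because [sin (theta_1 / 2)] increases
    up to [theta_1 = pi]. *)
Definition prior_lb : R := (2 * pi)^-1 * sin (pi / 4).

Lemma prior_lb_gt0 : 0 < prior_lb.
Proof.
have pi0 := pi_gt0 R.
by rewrite mulr_gt0 ?invr_gt0 ?mulr_gt0// sin_gt0_pi//; lra.
Qed.

Lemma prior_ge (t : param R) : pi / 2 <= t.1.2 <= pi -> prior_lb <= prior t.
Proof.
case: t => [[r t1] t2] /= /andP[h1 h2]; have pi0 := pi_gt0 R.
rewrite ler_pM2l ?invr_gt0 ?mulr_gt0//.
by rewrite leNgt ltr_sin ?in_itv /= -?leNgt; lra.
Qed.

(* [x `^ (-1)] is the inverse only for [0 <= x], that is for [r <= 1/2]; it is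
   preferred to [x^-1] because it is known to be measurable. *)
Definition qfi_lb (t : param R) : R := (2^-1 - t.1.1) `^ (-1) * prior_lb.

Lemma measurable_qfi_lb : measurable_fun setT qfi_lb.
Proof.
apply: measurable_funM; last exact: measurable_cst.
apply: (measurableT_comp (measurable_powR (-1))).
apply: measurable_funB; first exact: measurable_cst.
exact: (measurableT_comp measurable_fst measurable_fst).
Qed.

Lemma dyadic_boxP n t : dyadic_box n t ->
  [/\ 0 <= t.1.1 < 2^-1, 2^-1 - t.1.1 <= 2^-1 ^+ n.+1, Theta t
    & pi / 2 <= t.1.2 <= pi].
Proof.
move=> [[]] /=; rewrite !in_itv /= => /andP[h1 h2] /andP[h3 h4] /andP[h5 h6].
have e1 : 0 < (2^-1 : R) ^+ n.+2 by rewrite exprn_gt0.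
have e2 : (2^-1 : R) ^+ n.+1 <= 2^-1.
  by rewrite exprS ler_piMr// exprn_ile1// invf_le1// ler1n.
have pi0 := pi_gt0 R.
split; [by lra| by lra| | by lra].
by split; [split|] => /=; rewrite in_itv /=; lra.
Qed.

(** * Divergence of the average and the maximum *)

Lemma Fphi_pihalf_ket0 (az : R) : Fphi (pi / 2) (pi / 2) az (0, 0) = +oo%E.
Proof.
have pi0 := pi_gt0 R; have lb0 := prior_lb_gt0.
rewrite /Fphi /avg_QFI.
(* The constant is the lower bound [2 ^+ n.+1 * prior_lb] times the volume of box [n]; its factor
   [2^-1] is [2 ^+ n.+1 * 2^-1 ^+ n.+2]. *)
apply: (@integral_pinfty_pieces R _ _ (@lebesgue3 R) dyadic_box (@Theta R) _
  qfi_lb (2^-1 * prior_lb * (pi / 2) * (2 * pi))).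
- exact: measurable_dyadic_box.
- exact: trivIset_dyadic_box.
- exact: measurable_qfi_lb.
- by apply: measurableX; [apply: measurableX|]; exact: measurable_itv.
- by repeat apply: mulr_gt0 => //.
- move=> [[r t1] t2] [[]] /=; rewrite !in_itv /= => hr /andP[h1 h2] _.
  apply: mulr_ge0; first exact: trace_QFI_output_ge0.
  apply: mulr_ge0; first by rewrite invr_ge0 mulr_ge0 ?ltW.
  by apply: sin_ge0_pi; lra.
- by move=> n t /dyadic_boxP[].
- move=> n t /dyadic_boxP[ht _ _ ht1].
  have r2 : 0 <= 2^-1 - t.1.1 by lra.
  rewrite /qfi_lb powR_inv1//; apply/andP; split.
    by rewrite mulr_ge0 ?invr_ge0// ltW.
  apply: ler_pM; [by rewrite invr_ge0 | exact: ltW | |exact: prior_ge].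
  exact: trace_QFI_output_ge.
- move=> n; exists (2 ^+ n.+1 * prior_lb).
    move=> t /dyadic_boxP[ht rn _ _]; rewrite /qfi_lb powR_inv1; last by lra.
    rewrite ler_pM2r// -[2 ^+ _]invrK -exprVn lef_pV2 ?posrE ?exprn_gt0//.
    by lra.
  apply/andP; split; first by rewrite mulr_ge0 ?exprn_ge0// ltW.
  rewrite [X in (_ * X)%E](lebesgue3_dyadic_box n) -EFinM lee_fin.
  rewrite le_eqVlt; apply/orP; left; apply/eqP.
  have e : 2 ^+ n.+1 * 2^-1 ^+ n.+1 = 1 :> R by rewrite -exprMn mulfV// expr1n.
  by rewrite (exprS 2^-1 n.+1) !mulrA; ring: e.
Qed.

End QFI_divergence.

Theorem mainTheorem4 (R : realType) (az : R) (haz : 0 <= az <= pi / 2) :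
  is_max_of [set Fphi (pi / 2) (pi / 2) az phi | phi in @Phi R] (+oo)%E.
Proof.
(* As [+oo] is the top element, only attainment remains, and the probe |0> provides it. *)
split; last by move=> x _; exact: leey.
exists (0, 0); last exact: Fphi_pihalf_ket0.
by split => /=; rewrite in_itv /= lexx ?mulr_ge0 ?pi_ge0.
Qed.
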